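(* Let $N\geq 2$ be an even integer. Every complex structure $J$ on $\mathfrak{su}(2)^N$ is equivalent, under some member of $SO(3)^N$, to some $J(M)$ with $M=(\xi^{3i}_{3j})_{1\le i,j\le N}$ a real $N\times N$ matrix such that $M^2=-I$. Moreover, for real $N\times N$ matrices $M,M'$ with $M^2=M'^2=-I$: $J(M)$ and $J(M')$ are equivalent under some member of $SO(3)^N$ if and only if $M'=M$; and, for $\sigma\in\Sigma$, $J(M)$ and $J(M')$ are equivalent under some member of $\tau_\sigma(SO(3)^N)$ if and only if $M'=M^{\sigma^{-1}}$, where $M^{\sigma^{-1}}=\left(\xi^{3\sigma^{-1}(i)}_{3\sigma^{-1}(j)}\right)_{1\le i,j\le N}$.
   Context: $\mathfrak{su}(2)^N$ is the direct sum of $N$ copies of $\mathfrak{su}(2)$, with basis $(J^{(1)}_1,J^{(1)}_2,J^{(1)}_3,\dots,J^{(N)}_1,J^{(N)}_2,J^{(N)}_3)$, where for each $k$: $[J^{(k)}_1,J^{(k)}_2]=J^{(k)}_3$, $[J^{(k)}_2,J^{(k)}_3]=J^{(k)}_1$, $[J^{(k)}_3,J^{(k)}_1]=J^{(k)}_2$, and brackets between different factors vanish. Linear maps are identified with their matrices in this basis (columns are images of basis vectors). In matrices and block matrices, the upper index is the row index and the lower index the column index. For a real $N\times N$ matrix $M=(\xi^{3i}_{3j})_{1\le i,j\le N}$, $J(M)=(J^i_j(M))_{1\le i,j\le N}$ is the $3N\times3N$ matrix with $3\times 3$ blocks $J^i_i(M)=\begin{pmatrix}0&1&0\\-1&0&0\\0&0&\xi^{3i}_{3i}\end{pmatrix}$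 and $J^i_j(M)=\begin{pmatrix}0&0&0\\0&0&0\\0&0&\xi^{3i}_{3j}\end{pmatrix}$ for $i\ne j$. $SO(3)^N$ denotes the group of block-diagonal matrices $\mathrm{diag}(\Phi_1,\dots,\Phi_N)$ with $\Phi_i\in SO(3)$. $\Sigma$ is the set of circular permutations of $\{1,\dots,N\}$ having no fixed point, and $\tau_\sigma=(T^i_j)_{1\le i,j\le N}$ has $3\times3$ blocks $T^i_j=\delta_{i,\sigma(j)}I$ ($I$ the $3\times3$ identity, $\delta$ the Kronecker symbol); $\tau_\sigma(SO(3)^N)=\{\tau_\sigma\Phi:\Phi\in SO(3)^N\}$. A complex structure on a real Lie algebra $\mathfrak{g}$ is a linear map $J$ with $J^2=-1$ and $[JX,JY]-[X,Y]-J[JX,Y]-J[X,JY]=0$ for all $X,Y\in\mathfrak{g}$. $J$ and $J'$ are equivalent under some member of a set $S$ of automorphisms if $J'=\Psi J\Psi^{-1}$ for some $\Psi\in S$. *)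

(* Defs.v *)
From mathcomp Require Import all_boot all_order all_fingroup all_algebra.
From mathcomp Require Import reals ring.

Set Implicit Arguments.
Unset Strict Implicit.
Unset Printing Implicit Defensive.

Import Order.TTheory GRing.Theory Num.Theory.

Local Open Scope ring_scope.

Definition mx3 (R : realType) (rows : seq (seq R)) : 'M[R]_3 :=
  \matrix_(i, j) (nth [::] rows i)`_j.

(* Coordinates of su(2) in the basis (J_1, J_2, J_3), numbered from 0; the
   additions on 'I_3 are modulo 3, so that [J_k, J_(k+1)] = J_(k+2). *)
Definition su2_bracket (R : realType) (x y : 'cV[R]_3) : 'cV[R]_3 :=
  \col_(k < 3) (x (k + 1) 0 * y (k + 2%:R) 0 - x (k + 2%:R) 0 * y (k + 1) 0).

(* The direct sum of N copies of su(2): column vectors of coordinates, made of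
   N blocks of height 3. *)
Definition su2N_bracket (R : realType) (N : nat)
    (X Y : 'cV[R]_(\sum_(i < N) 3)) : 'cV[R]_(\sum_(i < N) 3) :=
  \mxcol_(i < N) su2_bracket (submxcol X i) (submxcol Y i).

Definition lie_bracket (R : realType) (n : nat)
    (br : 'cV[R]_n -> 'cV[R]_n -> 'cV[R]_n) : Prop :=
  [/\ forall a X Y Z, br (a *: X + Y) Z = a *: br X Z + br Y Z,
      forall a X Y Z, br Z (a *: X + Y) = a *: br Z X + br Z Y,
      forall X, br X X = 0 &
      forall X Y Z, br X (br Y Z) + br Y (br Z X) + br Z (br X Y) = 0].

(* J^(k)_a is su2N_basis R k a. *)
Definition su2N_basis (R : realType) (N : nat) (k : 'I_N) (a : 'I_3) :
    'cV[R]_(\sum_(i < N) 3) :=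
  \mxcol_(i < N) (if i == k then delta_mx a 0 else 0).

Definition complex_structure (R : realType) (n : nat)
    (br : 'cV[R]_n -> 'cV[R]_n -> 'cV[R]_n) (J : 'M[R]_n) : Prop :=
  J *m J = - 1%:M /\
  forall X Y : 'cV[R]_n,
    br (J *m X) (J *m Y) - br X Y - J *m br (J *m X) Y - J *m br X (J *m Y)
    = 0.

Definition lie_automorphism (R : realType) (n : nat)
    (br : 'cV[R]_n -> 'cV[R]_n -> 'cV[R]_n) (Psi : 'M[R]_n) : Prop :=
  Psi \in unitmx /\ forall X Y, Psi *m br X Y = br (Psi *m X) (Psi *m Y).

Definition equivalent_under (R : realType) (n : nat) (S : 'M[R]_n -> Prop)
    (J J' : 'M[R]_n) : Prop :=
  exists2 Psi, S Psi & J' = Psi *m J *m invmx Psi.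

Definition SO3 (R : realType) (A : 'M[R]_3) : Prop :=
  A^T *m A = 1%:M /\ \det A = 1.

Definition SO3N (R : realType) (N : nat) (A : 'M[R]_(\sum_(i < N) 3)) : Prop :=
  exists2 Phi : 'I_N -> 'M[R]_3,
    forall i, SO3 (Phi i) & A = \mxdiag_(i < N) Phi i.

Definition tau (R : realType) (N : nat) (s : 'S_N) :
    'M[R]_(\sum_(i < N) 3) :=
  \mxblock_(i < N, j < N) ((i == s j)%:R%:M : 'M[R]_3).

Definition tau_SO3N (R : realType) (N : nat) (s : 'S_N)
    (A : 'M[R]_(\sum_(i < N) 3)) : Prop :=
  exists2 Phi, SO3N Phi & A = tau R s *m Phi.

(* A circular permutation is a cycle: exactly one orbit is not a singleton. *)
Definition circular (N : nat) (s : 'S_N) : Prop :=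
  #|[set c in porbits s | (1 < #|c|)%N]| = 1%N.

Definition Sigma (N : nat) (s : 'S_N) : Prop :=
  circular s /\ forall i, s i != i.

Definition Jmx (R : realType) (N : nat) (M : 'M[R]_N) :
    'M[R]_(\sum_(i < N) 3) :=
  \mxblock_(i < N, j < N)
    if i == j then mx3 [:: [::  0; 1; 0];
                           [:: -1; 0; 0];
                           [::  0; 0; M i i]]
    else mx3 [:: [:: 0; 0; 0];
                 [:: 0; 0; 0];
                 [:: 0; 0; M i j]].

Definition perm_inv_mx (R : realType) (N : nat) (s : 'S_N) (M : 'M[R]_N) :
    'M[R]_N :=
  \matrix_(i, j) M ((s^-1)%g i) ((s^-1)%g j).


Section Checks.
Variables (R : realType) (N : nat).

Lemma ord3 (P : 'I_3 -> Prop) : P 0 -> P 1 -> P (2%:R) -> forall k, P k.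
Proof.
move=> P0 P1 P2 [[|[|[|//]]] lt_k3].
- by rewrite (_ : Ordinal _ = 0) //; apply: val_inj.
- by rewrite (_ : Ordinal _ = 1) //; apply: val_inj.
- by rewrite (_ : Ordinal _ = 2%:R) //; apply: val_inj.
Qed.

Lemma ord3E : ((1 + 1 : 'I_3) = 2%:R) * ((1 + 2%:R : 'I_3) = 0)
            * ((2%:R + 1 : 'I_3) = 0) * ((2%:R + 2%:R : 'I_3) = 1).
Proof. by do !split; apply: val_inj. Qed.

Lemma su2_bracketE (x y : 'cV[R]_3) :
  (su2_bracket x y 0 0 = x 1 0 * y 2%:R 0 - x 2%:R 0 * y 1 0)
  * (su2_bracket x y 1 0 = x 2%:R 0 * y 0 0 - x 0 0 * y 2%:R 0)
  * (su2_bracket x y 2%:R 0 = x 0 0 * y 1 0 - x 1 0 * y 0 0).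
Proof. by rewrite !mxE !add0r !ord3E. Qed.

Lemma col3P (x y : 'cV[R]_3) :
  x 0 0 = y 0 0 -> x 1 0 = y 1 0 -> x 2%:R 0 = y 2%:R 0 -> x = y.
Proof. by move=> ? ? ?; apply/matrixP => i j; rewrite ord1; elim/ord3: i. Qed.

Lemma sum3E (F : 'I_3 -> R) : \sum_i F i = F 0 + F 1 + F 2%:R.
Proof.
rewrite !big_ord_recl big_ord0 addr0 addrA.
by congr (_ + F _ + F _); apply: val_inj.
Qed.

Lemma su2_bracket_lie : lie_bracket (@su2_bracket R).
Proof.
split=> [a x y z|a x y z|x|x y z]; apply: col3P;
  do ?rewrite !su2_bracketE || rewrite mxE; ring.
Qed.

Lemma su2N_bracket_lie : lie_bracket (@su2N_bracket R N).
Proof.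
have [lD rD alt jac] := su2_bracket_lie.
have scol a (X : 'cV[R]_(\sum_(i < N) 3)) i :
  submxcol (a *: X) i = a *: submxcol X i.
  by apply/matrixP=> u v; rewrite !mxE.
split=> [a X Y Z|a X Y Z|X|X Y Z]; apply/mxcolP => i;
  do !rewrite ?submxcolD ?scol ?mxcolK ?submxcol0.
- exact: lD.
- exact: rD.
- exact: alt.
- exact: jac.
Qed.

Lemma su2N_bracket_basis (k l : 'I_N) (a : 'I_3) :
  su2N_bracket (su2N_basis R k a) (su2N_basis R l (a + 1))
  = if k == l then su2N_basis R k (a + 2%:R) else 0.
Proof.
apply/mxcolP => i; rewrite !mxcolK.
have [<-|nkl] := eqVneq k l; rewrite ?submxcol0 ?mxcolK.
  case: eqP => _; last by have [_ _ ->] := su2_bracket_lie.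
  elim/ord3: a; rewrite ?add0r ?ord3E; apply: col3P;
    rewrite !su2_bracketE !mxE /=; ring.
have [_ rD alt _] := su2_bracket_lie.
have [eik|_] := eqVneq i k; have [eil|_] := eqVneq i l.
- by rewrite -eik -eil eqxx in nkl.
- by apply: col3P; rewrite !su2_bracketE !mxE; ring.
- by apply: col3P; rewrite !su2_bracketE !mxE; ring.
- by rewrite alt.
Qed.

Lemma det3E (A : 'M[R]_3) :
  \det A = A 0 0 * (A 1 1 * A 2%:R 2%:R - A 1 2%:R * A 2%:R 1)
         - A 0 1 * (A 1 0 * A 2%:R 2%:R - A 1 2%:R * A 2%:R 0)
         + A 0 2%:R * (A 1 0 * A 2%:R 1 - A 1 1 * A 2%:R 0).
Proof.
pose a (i j : nat) := A (inord i) (inord j).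
have aE i j : A i j = a i j by rewrite /a !inord_val.
rewrite (expand_det_row _ 0) sum3E /cofactor !(expand_det_row _ ord0).
rewrite !big_ord_recl !big_ord0 /cofactor !det_mx11 !mxE !aE /=.
rewrite /bump /=; ring.
Qed.

Lemma SO3_bracket (A : 'M[R]_3) (x y : 'cV[R]_3) :
  SO3 A -> A *m su2_bracket x y = su2_bracket (A *m x) (A *m y).
Proof.
case=> AtA dA.
pose B : 'M[R]_3 := \matrix_(i, j)
  (A (i + 1) (j + 1) * A (i + 2%:R) (j + 2%:R)
   - A (i + 1) (j + 2%:R) * A (i + 2%:R) (j + 1)).
have AB : A = B.
  apply: trmx_inj; rewrite -[B^T]mul1mx -AtA -mulmxA.
  suff -> : A *m B^T = 1%:M by rewrite mulmx1.
  have d1 := det3E A; rewrite dA in d1.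
  apply/matrixP; do 2!elim/ord3; rewrite !mxE sum3E !mxE ?add0r ?ord3E /=
    ?mulr1n ?mulr0n ?d1; ring.
rewrite {1}AB; apply: col3P; rewrite !su2_bracketE;
  do !rewrite !mxE ?sum3E ?add0r ?ord3E; ring.
Qed.

Lemma SO3_unit (A : 'M[R]_3) : SO3 A -> A \in unitmx.
Proof. by case=> _ dA; rewrite unitmxE dA unitr1. Qed.

Lemma mul_tau_mxcol m (s : 'S_N) (C : 'I_N -> 'M[R]_(3, m)) :
  tau R s *m \mxcol_(i < N) C i = \mxcol_(i < N) C ((s^-1)%g i).
Proof.
rewrite /tau mul_mxblock_mxrow.
apply/eq_mxcol => i; rewrite (bigD1 ((s^-1)%g i)) //= permKV eqxx mul1mx.
rewrite big1 ?addr0 // => j nj; have [eij|_] := eqVneq i (s j).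
  by rewrite eij permK eqxx in nj.
by rewrite -scalemx1 scale0r mul0mx.
Qed.

Lemma SO3N_automorphism (Psi : 'M[R]_(\sum_(i < N) 3)) :
  SO3N Psi -> lie_automorphism (@su2N_bracket R N) Psi.
Proof.
case=> Phi PhiSO ->; split.
  have /mulmx1_unit[] // : (\mxdiag_i Phi i) *m (\mxdiag_i (Phi i)^T) = 1%:M.
  rewrite -[X in _ *m X]mulmx1 -[X in _ *m (_ *m X)]submxcolK.
  rewrite !mul_mxdiag_mxcol -[RHS]submxcolK; apply/eq_mxcol => i.
  by rewrite mulmxA (mulmx1C (proj1 (PhiSO i))) mul1mx.
move=> X Y; rewrite /su2N_bracket mul_mxdiag_mxcol; apply/eq_mxcol => i.
rewrite -{2}[X]submxcolK -{2}[Y]submxcolK !mul_mxdiag_mxcol !mxcolK.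
exact: SO3_bracket.
Qed.

Lemma tau_automorphism (s : 'S_N) :
  lie_automorphism (@su2N_bracket R N) (tau R s).
Proof.
split.
  have /mulmx1_unit[] // : tau R s *m tau R s^-1 = 1%:M.
  rewrite -[X in _ *m X]mulmx1 -[X in _ *m (_ *m X)]submxcolK.
  rewrite !mul_tau_mxcol invgK -[RHS]submxcolK; apply/eq_mxcol => i.
  by rewrite permKV.
move=> X Y; rewrite /su2N_bracket mul_tau_mxcol; apply/eq_mxcol => i.
by rewrite -{2}[X]submxcolK -{2}[Y]submxcolK !mul_tau_mxcol !mxcolK.
Qed.

Lemma tau_SO3N_automorphism (s : 'S_N) (Psi : 'M[R]_(\sum_(i < N) 3)) :
  tau_SO3N s Psi -> lie_automorphism (@su2N_bracket R N) Psi.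
Proof.
case=> Phi /SO3N_automorphism[uPhi brPhi] ->.
have [utau brtau] := tau_automorphism s; split; first by rewrite unitmx_mul utau.
by move=> X Y; rewrite -!mulmxA brPhi brtau.
Qed.

End Checks.

(* Main.v *)
Require Import Defs.
From mathcomp Require Import all_boot all_order all_fingroup all_algebra.
From mathcomp Require Import reals ring lra.

(** Let [H] represent the functional [Y |-> tr (J ad Y)].  The heart of the
    proof is the identity, with [A = ad X], [C = ad (J X)], [D = A J - J A],
    [K = (J - J^T)^-1], [U = J K] and [V = K J],
      [tr (J ad [X, J X]) = -2 tr (U D^T V D)].
    As [U] and [V] are positive definite, [ad X] commutes with [J] as soon as
    [H] is orthogonal to the bracket of [X] and [J X], in particular when [X]
    commutes with [H].  The component [v_i] of [H] in the i-th factor is, up to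
    a factor, the axial vector of the block [J_ii].  It is nonzero: otherwise [J] would commute with the whole
    i-th factor, hence preserve this space of odd dimension 3.  Taking [X = v_i]
    now, [J] commutes with [ad v_i], hence preserves its image, a plane on which
    it is a rotation by a right angle, and the span of [v_1, ..., v_N].  Rotating
    each [v_i] to the positive third axis gives the normal form [J(M)].
    Conversely an element of [SO(3)^N] conjugating [J(M)] to [J(M')] maps the
    axial vectors of the diagonal blocks to each other, thus fixes the third
    axes, and [M' = M].  In complex terms, [J K + i K] is the orthogonal
    projector onto an eigenspace of [J]. *)

Set Implicit Arguments.
Unset Strict Implicit.
Unset Printing Implicit Defensive.

Import Order.TTheory GRing.Theory Num.Theory.

Local Open Scope ring_scope.

(** * Positivity of the trace form [tr (A^T A)] *)

Section TraceGram.
Variables (R : realFieldType) (m n : nat).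
Implicit Type A : 'M[R]_(m, n).

Lemma mxtrace_gram A : \tr (A^T *m A) = \sum_j \sum_i A i j ^+ 2.
Proof.
by apply: eq_bigr => j _; rewrite mxE; apply: eq_bigr => i _; rewrite !mxE.
Qed.

Lemma mxtrace_gram_ge0 A : 0 <= \tr (A^T *m A).
Proof.
by rewrite mxtrace_gram; do 2!apply: sumr_ge0 => ? _; apply: sqr_ge0.
Qed.

Lemma mxtrace_gram_eq0 A : \tr (A^T *m A) = 0 -> A = 0.
Proof.
rewrite mxtrace_gram => /eqP; rewrite psumr_eq0 => [/allP A0|j _]; last first.
  by apply: sumr_ge0 => i _; apply: sqr_ge0.
apply/matrixP => i j; rewrite mxE; have /(_ (mem_index_enum j)) := A0 j.
rewrite /= psumr_eq0 => [/allP/(_ i (mem_index_enum i))|k _]; last exact: sqr_ge0.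
by rewrite /= sqrf_eq0 => /eqP.
Qed.

End TraceGram.

(** * Trace identities for a matrix [J] of square -1 *)

Section ComplexStructureVariation.
Variables (R : realFieldType) (n : nat) (J : 'M[R]_n).
Hypothesis J2 : J *m J = - 1%:M.

Let K := invmx (J - J^T).

(** A row [x] with [x J = x J^T] satisfies [|x J|^2 = x J J x^T = - |x|^2], hence is zero. *)
Lemma sub_trmx_unitmx : J - J^T \in unitmx.
Proof.
rewrite -row_free_unit; apply: inj_row_free => x.
rewrite mulmxBr => /eqP; rewrite subr_eq0 => /eqP xJ.
apply: trmx_inj; rewrite trmx0; apply: mxtrace_gram_eq0; apply: le_anti.
rewrite mxtrace_gram_ge0 andbT -oppr_ge0.
suff -> : - \tr (x^T^T *m x^T) = \tr ((x *m J)^T^T *m (x *m J)^T).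
  exact: mxtrace_gram_ge0.
by rewrite {2}xJ !trmxK trmx_mul !trmxK !mulmxA -[_ *m J *m J]mulmxA J2
  mulmxN mulmx1 mulNmx raddfN.
Qed.

Let GK : (J - J^T) *m K = 1%:M.
Proof. by rewrite mulmxV ?sub_trmx_unitmx. Qed.

Let KG : K *m (J - J^T) = 1%:M.
Proof. by rewrite mulVmx ?sub_trmx_unitmx. Qed.

Let trK : K^T = - K.
Proof.
have trG : J - J^T = - (J - J^T)^T by rewrite raddfB /= trmxK opprB.
rewrite -[LHS]mulmx1 -GK mulmxA {1}trG mulmxN -trmx_mul GK trmx1.
by rewrite mulNmx mul1mx.
Qed.

Let trJ2 : J^T *m J^T = - 1%:M.
Proof. by rewrite -trmx_mul J2 linearN /= trmx1. Qed.

Let KtrJ : K *m J^T = - (J *m K).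
Proof.
rewrite -[K *m J^T]mulmx1 -GK -[J *m K]mul1mx -KG !mulmxA -mulNmx; congr (_ *m K).
rewrite -!mulmxA -mulmxN; congr (_ *m _).
by rewrite mulmxBr mulmxBl trJ2 J2 opprB.
Qed.

Let KJD : J *m K + K *m J = 1%:M.
Proof. by rewrite -KG mulmxBr KtrJ opprK addrC. Qed.

Let trJK : J^T *m K = - (K *m J).
Proof.
by apply/eqP; rewrite -subr_eq0 opprK -[J^T *m K](subKr (J *m K)) -mulmxBl GK
  addrAC KJD subrr.
Qed.

(** Positive definiteness of [J K], which equals [K^T (1 + J^T J) K]; likewise below
    [K J = K^T (1 + J J^T) K]. *)
Let JK_gram : J *m K = K^T *m K + (J *m K)^T *m (J *m K).
Proof.
rewrite trmx_mul -mulmxA (mulmxA J^T) -[X in K^T *m X + _]mul1mx.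
rewrite -mulmxDr -mulmxDl trK.
have -> : 1%:M + J^T *m J = - ((J - J^T) *m J).
  by rewrite mulmxBl J2 opprB opprK addrC.
by rewrite !mulNmx mulmxN opprK !mulmxA KG mul1mx.
Qed.

Let KJ_gram : K *m J = K^T *m K + (J^T *m K)^T *m (J^T *m K).
Proof.
rewrite trmx_mul trmxK -mulmxA (mulmxA J) -[X in K^T *m X + _]mul1mx.
rewrite -mulmxDr -mulmxDl trK.
have -> : 1%:M + J *m J^T = - (J *m (J - J^T)).
  by rewrite mulmxBr J2 opprB opprK addrC.
by rewrite !mulNmx mulmxN opprK -!mulmxA GK mulmx1.
Qed.

Let mxtrace_gram2 (P Q D : 'M[R]_n) :
  \tr (P^T *m P *m D^T *m (Q^T *m Q) *m D)
  = \tr ((Q *m D *m P^T)^T *m (Q *m D *m P^T)).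
Proof.
by rewrite !trmx_mul trmxK !mulmxA [RHS]mxtrace_mulC !mulmxA.
Qed.

(** The two Gram decompositions split the trace into four squared norms, one of which is that of
    [K D K^T]; and [K] is invertible. *)
Lemma mxtrace_twisted_gram_eq0 (D : 'M[R]_n) :
  \tr (J *m K *m D^T *m (K *m J) *m D) = 0 -> D = 0.
Proof.
rewrite JK_gram KJ_gram !(mulmxDl, mulmxDr) !mxtraceD !mxtrace_gram2 => T0.
have KDK0 : K *m D *m K^T = 0.
  apply: mxtrace_gram_eq0; apply: le_anti; rewrite mxtrace_gram_ge0 andbT -T0.
  by rewrite -!addrA lerDl !addr_ge0 ?mxtrace_gram_ge0.
rewrite -[D]mul1mx -GK -[D]mulmx1 -KG -[X in D *m (X *m _)]opprK -trK.
by rewrite mulNmx !mulmxN !mulmxA -(mulmxA _ K D) -(mulmxA _ (K *m D)) KDK0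
  mulmx0 mul0mx oppr0.
Qed.

(* The projectors [(1 - i J) / 2] and [J K + i K] have the same image, which is
   stable under [B - i A]; so both yield the trace of [B - i A] on it. *)
Lemma mxtrace_mate (A B : 'M[R]_n) :
    A^T = - A -> A *m J - J *m A = J *m (B *m J - J *m B) -> B^T = - B ->
  \tr (K *m A) *+ 2 = - \tr (J *m A).
Proof.
move=> trA AJ trB; pose L := B - A *m J.
have JL : J *m L = L *m J.
  have E : J *m A *m J + A = J *m B - B *m J.
    move/(congr1 (mulmx J)): AJ; rewrite mulmxBr [J *m (J *m A)]mulmxA.
    by rewrite [J *m (J *m _)]mulmxA J2 !mulNmx !mul1mx opprB opprK mulmxA.
  rewrite mulmxBr mulmxBl -[A *m J *m J]mulmxA J2 mulmxN mulmx1 opprK mulmxA.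
  by apply/eqP; rewrite subr_eq -addrA [A + _]addrC E addrC subrK.
have trUL : \tr (J *m K *m L) = \tr (K *m A).
  have trU : (J *m K)^T = J *m K by rewrite trmx_mul trK mulNmx KtrJ opprK.
  have trUB : \tr (J *m K *m B) = 0.
    have : \tr (J *m K *m B) = - \tr (J *m K *m B).
      by rewrite -{1}mxtrace_tr trmx_mul trU trB mulNmx raddfN /= mxtrace_mulC.
    lra.
  rewrite mulmxBr raddfB /= trUB sub0r mulmxA mxtrace_mulC !mulmxA J2.
  by rewrite !mulNmx mul1mx raddfN opprK.
have trVL : \tr (K *m J *m L) = \tr (J *m K *m L).
  by rewrite -mulmxA JL mulmxA mxtrace_mulC mulmxA.
have trB0 : \tr B = 0.
  have : \tr B = - \tr B by rewrite -{1}mxtrace_tr trB raddfN.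
  lra.
rewrite mulr2n -{1}trUL -trVL -trUL -mxtraceD -mulmxDl addrC KJD mul1mx.
by rewrite raddfB /= trB0 sub0r mxtrace_mulC.
Qed.

(** Since [K A - A K = K (D - D^T) K], the left side is [tr (K (D - D^T) K C) = 2 tr (K D K C)].
    Substituting [D^T = J^T C J^T + C] in [tr (K D^T K D)] gives the same two equal terms. *)
Lemma mxtrace_commutator (A C : 'M[R]_n) (D := A *m J - J *m A) :
    A^T = - A -> C^T = - C -> C *m J - J *m C = J *m D ->
  \tr (K *m (A *m C - C *m A)) = \tr (J *m K *m D^T *m (K *m J) *m D).
Proof.
move=> trA trC CJ.
(* Equivalently, [D] anticommutes with [J]. *)
have JDJ : J *m D *m J = D.
  rewrite /D mulmxBr mulmxBl !mulmxA J2 -!mulmxA J2 !mulNmx !mulmxN mul1mx.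
  by rewrite !mulmx1 opprK addrC.
have trD : D^T = A *m J^T - J^T *m A.
  by rewrite /D linearB /= !trmx_mul trA mulmxN mulNmx opprK addrC.
have trDC : D^T = J^T *m C *m J^T + C.
  rewrite -{1}JDJ !trmx_mul -trmx_mul -CJ linearB /= !trmx_mul trC mulmxN mulNmx.
  by rewrite opprK mulmxDr mulmxN !mulmxA trJ2 mulNmx mul1mx opprK addrC.
have trDKC : \tr (K *m D^T *m K *m C) = - \tr (K *m D *m K *m C).
  rewrite -mxtrace_tr !trmx_mul trmxK trK trC !(mulNmx, mulmxN) !opprK raddfN /=.
  by rewrite mxtrace_mulC !mulmxA.
have KA : K *m A - A *m K = K *m (D - D^T) *m K.
  have -> : D - D^T = A *m (J - J^T) - (J - J^T) *m A.
    rewrite trD /D mulmxBr mulmxBl !opprB -!addrA; congr (_ + _).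
    by rewrite addrCA [RHS]addrCA [- _ - _]addrC.
  by rewrite mulmxBr mulmxBl !mulmxA KG -!mulmxA GK mulmx1 mul1mx.
have -> : \tr (K *m (A *m C - C *m A)) = \tr (K *m D *m K *m C) *+ 2.
  rewrite mulmxBr raddfB /= !mulmxA [X in _ - X]mxtrace_mulC.
  rewrite mulmxA -raddfB -mulmxBl.
  by rewrite KA mulmxBr !mulmxBl raddfB /= trDKC opprK mulr2n.
have -> : \tr (J *m K *m D^T *m (K *m J) *m D) = \tr (K *m D^T *m K *m D).
  by rewrite -!mulmxA mxtrace_mulC -!mulmxA [J *m (D *m J)]mulmxA JDJ.
clearbody D; rewrite trDC mulmxDr !mulmxDl mxtraceD mulr2n.
congr (_ + _); last first.
  by rewrite -mulmxA mxtrace_mulC mulmxA.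
rewrite !mulmxA KtrJ -(mulmxA _ J^T K) trJK !(mulNmx, mulmxN) opprK -!mulmxA.
rewrite [RHS]mxtrace_mulC -!mulmxA [J *m (D *m J)]mulmxA JDJ (mulmxA K C).
by rewrite [RHS]mxtrace_mulC !mulmxA.
Qed.

(** In the application [A], [C], [B], [E] are the adjoint matrices of [X], [J X], [[X, J X]] and [-
    J [X, J X]]. The relation between [B] and [E] turns [tr (J B) = 0] into [tr (K B) = 0], the
    vanishing of the definite form at [A J - J A]. *)
Lemma commute_of_mxtrace_eq0 (A C E : 'M[R]_n) (B := A *m C - C *m A) :
    A^T = - A -> C^T = - C -> E^T = - E -> B^T = - B ->
    C *m J - J *m C = J *m (A *m J - J *m A) ->
    B *m J - J *m B = J *m (E *m J - J *m E) ->
  \tr (J *m B) = 0 -> A *m J = J *m A.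
Proof.
move=> trA trC trE trB CJ BJ trJB.
apply/eqP; rewrite -subr_eq0; apply/eqP; apply: mxtrace_twisted_gram_eq0.
rewrite -(mxtrace_commutator trA trC CJ).
by move/eqP: (mxtrace_mate trB BJ trE); rewrite trJB oppr0 mulrn_eq0 => /eqP.
Qed.

End ComplexStructureVariation.

Lemma eq_mulmx_cV (R : pzRingType) m n (A B : 'M[R]_(m, n)) :
  (forall y : 'cV_n, A *m y = B *m y) -> A = B.
Proof.
move=> eqAB; apply/matrixP => i j; have := eqAB (delta_mx j 0).
by rewrite -!colE => /matrixP/(_ i 0); rewrite !mxE.
Qed.

(** * Adjoint matrices of su(2) and axial vectors *)

Section Hat.
Variable R : realType.
Implicit Types (x y : 'cV[R]_3) (A B : 'M[R]_3).

Definition hat x : 'M[R]_3 :=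
  mx3 [:: [:: 0; - x 2%:R 0; x 1 0];
          [:: x 2%:R 0; 0; - x 0 0];
          [:: - x 1 0; x 0 0; 0]].

Lemma hatE x y : hat x *m y = su2_bracket x y.
Proof.
by apply: col3P; rewrite su2_bracketE mxE sum3E !mxE /=; ring.
Qed.

Lemma tr_hat x : (hat x)^T = - hat x.
Proof.
by apply/matrixP; do 2!elim/ord3; rewrite !mxE /= ?oppr0 ?opprK.
Qed.

Lemma hat_bracket x y :
  hat (su2_bracket x y) = hat x *m hat y - hat y *m hat x.
Proof.
apply/matrixP; do 2!elim/ord3;
  rewrite !mxE /= ?mxE !sum3E !mxE ?add0r ?ord3E /=; ring.
Qed.

Lemma hat0 : hat 0 = 0.
Proof. by apply/matrixP; do 2!elim/ord3; rewrite !mxE /= ?mxE ?oppr0. Qed.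

Lemma hat_conj A x : SO3 A -> A *m hat x *m A^T = hat (A *m x).
Proof.
move=> SA; apply: eq_mulmx_cV => y; rewrite -!mulmxA hatE SO3_bracket // hatE.
by rewrite (mulmxA A) (mulmx1C (proj1 SA)) mul1mx.
Qed.

(** The vector dual to [x |-> tr (B hat x)]: a multiple of the axial vector of [B], equal to [-2 x]
    for [B = hat x]. *)
Definition skew_vec B : 'cV[R]_3 :=
  \col_k (B (k + 1) (k + 2%:R) - B (k + 2%:R) (k + 1)).

Lemma mxtrace_mul_hat B x :
  \tr (B *m hat x) = \sum_k skew_vec B k 0 * x k 0.
Proof.
rewrite /mxtrace !sum3E !mxE !sum3E !mxE ?add0r ?ord3E /=; ring.
Qed.

End Hat.

(** * Adjoint matrices of the direct sum and commutation with [J] *)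

Section Ad.
Variables (R : realType) (N : nat).
Implicit Types X Y : 'cV[R]_(\sum_(i < N) 3).

Definition adm X : 'M[R]_(\sum_(i < N) 3) := \mxdiag_i hat (submxcol X i).

Lemma admE X Y : adm X *m Y = su2N_bracket X Y.
Proof.
rewrite -{1}[Y]submxcolK mul_mxdiag_mxcol; apply/eq_mxcol => i.
exact: hatE.
Qed.

Lemma tr_adm X : (adm X)^T = - adm X.
Proof.
by rewrite tr_mxdiag -mxdiagN; apply/eq_mxdiag => i; rewrite tr_hat.
Qed.

Lemma adm_bracket X Y : adm (su2N_bracket X Y) = adm X *m adm Y - adm Y *m adm X.
Proof.
apply: eq_mulmx_cV => Z; rewrite mulmxBl -!mulmxA !admE.
apply/mxcolP => i; rewrite submxcolB !mxcolK -(hatE (su2_bracket _ _)).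
by rewrite hat_bracket mulmxBl -!mulmxA !hatE.
Qed.

(** The integrability condition, read as an identity between operators acting on [Y]. *)
Lemma complex_structure_adm (J : 'M[R]_(\sum_(i < N) 3)) X :
    complex_structure (@su2N_bracket R N) J ->
  adm (J *m X) *m J - J *m adm (J *m X) = J *m (adm X *m J - J *m adm X).
Proof.
case=> J2 NJ; apply: eq_mulmx_cV => Y; move: (NJ X Y).
rewrite -!admE mulmxBr !mulmxBl !mulmxA J2 mulNmx mul1mx mulNmx opprK => /eqP.
rewrite subr_eq0 => /eqP <-.
by rewrite addrAC subrK.
Qed.

Lemma commute_of_block_trace (J : 'M[R]_(\sum_(i < N) 3)) (i : 'I_N) (x : 'cV_3)
    (X := \mxcol_k (if k == i then x else 0)) :
    complex_structure (@su2N_bracket R N) J ->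
    (forall y, \tr (submxblock J i i *m hat (su2_bracket x y)) = 0) ->
  adm X *m J = J *m adm X.
Proof.
move=> csJ trJi; have [J2 _] := csJ.
pose B := su2N_bracket X (J *m X).
(* The vector [- J B] is chosen because [J] maps it to [B]: integrability at this vector relates its
   adjoint matrix to that of [B]. *)
apply: (@commute_of_mxtrace_eq0 _ _ _ J2 _ (adm (J *m X)) (adm (- (J *m B))));
  rewrite -?adm_bracket ?tr_adm //.
- exact: complex_structure_adm.
- have {1 2}-> : su2N_bracket X (J *m X) = J *m - (J *m B).
    by rewrite mulmxN mulmxA J2 mulNmx mul1mx opprK.
  exact: complex_structure_adm.
(* As [X] lies in the i-th factor, so does [[X, J X]]: only the i-th diagonal block contributes. *)
rewrite -[J]submxblockK mul_mxblock_mxdiag mxtrace_mxblock big1 // => k _.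
rewrite mxcolK mxcolK; case: eqP => [->|_]; first exact: trJi.
by rewrite -hatE hat0 mul0mx hat0 mulmx0 mxtrace0.
Qed.

End Ad.

(** * Rotating a unit vector to the third axis *)

Section Rotation.
Variable R : realType.

Definition e3 : 'cV[R]_3 := delta_mx 2%:R 0.

Lemma SO3_to_e3 (u : 'cV[R]_3) :
  \sum_k u k 0 ^+ 2 = 1 -> exists2 A, SO3 A & A *m u = e3.
Proof.
pose a := u 0 0; pose b := u 1 0; pose c := u 2%:R 0.
rewrite sum3E -/a -/b -/c => u1.
have [c1|cN1] := eqVneq c (- 1).
  have [a0 b0] : a = 0 /\ b = 0 by split; nra.
  (* Here [u = - e3], and a half-turn about the first axis serves. *)
  exists (mx3 [:: [:: 1; 0; 0]; [:: 0; -1; 0]; [:: 0; 0; -1]]).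
    split; last by rewrite det3E !mxE /=; ring.
    by apply/matrixP; do 2!elim/ord3; rewrite !mxE sum3E !mxE /=; ring.
  by apply: col3P; rewrite !mxE sum3E !mxE -/a -/b -/c a0 b0 c1 /=; ring.
have c1n0 : 1 + c != 0 by rewrite addrC addr_eq0.
pose d := (1 + c)^-1; have D : d * (1 + c) = 1 by rewrite mulVf.
have E : d * (a ^+ 2 + b ^+ 2) = 1 - c.
  by rewrite (_ : _ + _ = (1 + c) * (1 - c)); [rewrite mulrA D mul1r|lra].
have mulE x : x * (d * (a ^+ 2 + b ^+ 2)) = x * (1 - c) by rewrite E.
have mulD x : x * (d * (1 + c)) = x by rewrite D mulr1.
(* Rodrigues' formula for the rotation about [u x e3] taking [u] to [e3]. *)
exists (mx3 [:: [:: 1 - a ^+ 2 * d; - (a * b * d); - a];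
                [:: - (a * b * d); 1 - b ^+ 2 * d; - b];
                [:: a; b; c]]).
  split.
    (* These multiples of the relations for [d] make the remaining goals linear in the monomials. *)
    have := (mulE (a ^+ 2 * d), mulD (a ^+ 2), mulE (b ^+ 2 * d), mulD (b ^+ 2)).
    have := (mulE (a * b * d), mulD (a * b), mulE a, mulE b).
    move=> [[[? ?] ?] ?] [[[? ?] ?] ?].
    by apply/matrixP; do 2!elim/ord3; rewrite !mxE sum3E !mxE /=; lra.
  by have := mulE c; rewrite det3E !mxE /=; lra.
have [? ?] := (mulE a, mulE b).
by apply: col3P; rewrite !mxE sum3E !mxE -/a -/b -/c /=; lra.
Qed.

End Rotation.

Lemma adm_commute (R : realType) (N : nat) (X : 'cV[R]_(\sum_(i < N) 3))
    (J : 'M[R]_(\sum_(i < N) 3)) :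
  adm X *m J = J *m adm X ->
  forall i j, hat (submxcol X i) *m submxblock J i j
              = submxblock J i j *m hat (submxcol X j).
Proof.
rewrite /adm -[J]submxblockK mul_mxdiag_mxblock mul_mxblock_mxdiag.
by move=> /eq_mxblockP XJ i j; rewrite mxblockK; apply: XJ.
Qed.

(** * Blocks of [J] and the axial vectors of its diagonal blocks *)

Section NormalForm.
Variables (R : realType) (N : nat).
Implicit Types (J : 'M[R]_(\sum_(i < N) 3)) (A B : 'M[R]_3).

(** Otherwise [J] commutes with [ad X] for every [X] in the i-th factor. Every [hat x] then kills
    [J_ij] for [j != i], so these blocks vanish and [J_ii] is a 3 by 3 matrix of square -1, whose
    determinant would have square -1. *)
Lemma skew_vec_neq0 J i :
  complex_structure (@su2N_bracket R N) J ->
  skew_vec (submxblock J i i) != 0.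
Proof.
move=> csJ; apply/eqP => v0.
have J0 j : j != i -> submxblock J i j = 0.
  move=> nji; have hatJ x : hat x *m submxblock J i j = 0.
    have /adm_commute/(_ i j) :
        adm (\mxcol_k (if k == i then x else 0)) *m J
        = J *m adm (\mxcol_k (if k == i then x else 0)).
      apply: commute_of_block_trace => // y.
      by rewrite mxtrace_mul_hat v0 big1 // => k _; rewrite mxE mul0r.
    by rewrite !mxcolK eqxx (negPf nji) hat0 mulmx0.
  have /matrixP h0 := hatJ (delta_mx 0 0).
  have /matrixP h1 := hatJ (delta_mx 1 0).
  apply/matrixP; elim/ord3 => k.
  - by have := h1 2%:R k; rewrite mxE sum3E !mxE /=; lra.
  - by have := h0 2%:R k; rewrite mxE sum3E !mxE /=; lra.
  - by have := h0 1 k; rewrite mxE sum3E !mxE /=; lra.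
have : submxblock J i i *m submxblock J i i = - 1%:M.
  have := csJ.1; rewrite -{1 2}[J]submxblockK mul_mxblock.
  move/(congr1 (fun X => submxblock X i i)); rewrite mxblockK (bigD1 i) //=.
  rewrite big1 ?addr0 => [->|j nji]; last by rewrite J0 ?mul0mx.
  by rewrite submxblockN -mxdiagZ submxblock_diag.
move/(congr1 determinant); rewrite det_mulmx -scaleN1r detZ det1 mulr1 -expr2.
by move=> detJ; have := sqr_ge0 (\det (submxblock J i i)); rewrite detJ; lra.
Qed.

(** The matrix [A] rotates [v / |v|] to [e3]; the commutation of [J] with the adjoint matrix of [v],
    placed in the i-th factor, is then read block by block. *)
Lemma SO3_normal_block J i :
  complex_structure (@su2N_bracket R N) J ->
  exists A, [/\ SO3 A,
    hat (e3 R) *m (A *m submxblock J i i *m A^T)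
    = A *m submxblock J i i *m A^T *m hat (e3 R),
    0 < skew_vec (A *m submxblock J i i *m A^T) 2%:R 0,
    forall j, j != i -> hat (e3 R) *m (A *m submxblock J i j) = 0 &
    forall j, j != i -> submxblock J j i *m A^T *m hat (e3 R) = 0].
Proof.
move=> csJ; set v := skew_vec (submxblock J i i).
pose q := \sum_k v k 0 ^+ 2; pose s := Num.sqrt q.
have q_gt0 : 0 < q.
  rewrite lt_def sumr_ge0 ?andbT => [|k _]; last exact: sqr_ge0.
  apply: contraNneq (skew_vec_neq0 i csJ) => q0; apply/eqP/matrixP => k l.
  rewrite ord1 [RHS]mxE; apply/eqP; rewrite -sqrf_eq0.
  move/eqP: q0; rewrite psumr_eq0 => [/allP/(_ k (mem_index_enum k))|j _] //.
  exact: sqr_ge0.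
have s_gt0 : 0 < s by rewrite sqrtr_gt0.
have [] := @SO3_to_e3 R (s^-1 *: v).
  under eq_bigr do rewrite mxE exprMn.
  rewrite -mulr_sumr exprVn sqr_sqrtr ?ltW //.
  by rewrite mulVf ?gt_eqF.
move=> A SA Au; have AtA := SA.1.
have hv : A *m hat v *m A^T = s *: hat (e3 R).
  rewrite hat_conj // -(scalerKV (lt0r_neq0 s_gt0) (A *m v)) scalemxAr Au.
  by apply/matrixP; do 2!elim/ord3; rewrite !mxE /= ?mxE /=; ring.
have hv1 : hat (e3 R) = s^-1 *: (A *m hat v *m A^T).
  by rewrite hv scalerA mulVf ?scale1r ?gt_eqF.
have comm : forall j k,
    hat (submxcol (\mxcol_k (if k == i then v else 0)) j) *m submxblock J j k
    = submxblock J j k *m hat (submxcol (\mxcol_k (if k == i then v else 0)) k).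
  (* The trace condition is the vanishing of the triple product of [v], [v] and [y]. *)
  apply/adm_commute/(commute_of_block_trace csJ) => y.
  rewrite mxtrace_mul_hat -/v sum3E !su2_bracketE; ring.
exists A; split=> // [||j nji|j nji].
- have := comm i i; rewrite mxcolK eqxx => cii.
  rewrite hv1 -scalemxAl -scalemxAr -!mulmxA !(mulmxA A^T A) AtA !mul1mx.
  by rewrite !(mulmxA (hat v)) cii !mulmxA.
(* The third component of the rotated axial vector is [|v| = q / s]. *)
- suff <- : s^-1 * q = skew_vec (A *m submxblock J i i *m A^T) 2%:R 0.
    by rewrite mulr_gt0 ?invr_gt0.
  have := mxtrace_mul_hat (A *m submxblock J i i *m A^T) (e3 R).
  rewrite [RHS]sum3E ![e3 R _ _]mxE !mulr0 !add0r mulr1 => <-.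
  rewrite hv1 -scalemxAr mxtraceZ -!mulmxA (mulmxA A^T A) AtA mul1mx.
  rewrite mxtrace_mulC -!mulmxA AtA mulmx1 mxtrace_mul_hat.
  by congr (_ * _); apply: eq_bigr => k _; rewrite expr2.
- have := comm i j; rewrite !mxcolK eqxx (negPf nji) hat0 mulmx0 => cij.
  by rewrite hv1 -scalemxAl -!mulmxA (mulmxA A^T A) AtA mul1mx cij mulmx0 scaler0.
- have := comm j i; rewrite !mxcolK eqxx (negPf nji) hat0 mul0mx => cji.
  rewrite hv1 -scalemxAr -!mulmxA (mulmxA A^T A) AtA mul1mx.
  by rewrite (mulmxA (submxblock _ _ _)) -cji mul0mx scaler0.
Qed.

End NormalForm.

(** Commutation gives [B] the diagonal blocks [[a, b; -b, a]] and a corner entry. The first row of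
    the square yields [a^2 - b^2 = -1] and [2 a b = 0], and the skew condition [b > 0], so [a = 0]
    and [b = 1]. *)
Lemma hat_e3_commute_normal (R : realType) (B : 'M[R]_3) :
    hat (e3 R) *m B = B *m hat (e3 R) -> 0 < skew_vec B 2%:R 0 ->
    (forall k, (B *m B) 0 k = - (0 == k)%:R) ->
  B = mx3 [:: [:: 0; 1; 0]; [:: -1; 0; 0]; [:: 0; 0; B 2%:R 2%:R]].
Proof.
move=> /matrixP comm skew B2.
have := (comm 0 0, comm 0 1, comm 0 2%:R, comm 1 2%:R, comm 2%:R 0, comm 2%:R 1).
have := (B2 0, B2 1); move: skew.
rewrite !mxE !sum3E !mxE ?add0r ?ord3E /= => skew [b0 b1].
move=> [[[[[h00 h01] h02] h12] h20] h21].
have B11 : B 1 1 = B 0 0 by lra.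
have B10 : B 1 0 = - B 0 1 by lra.
have B00 : B 0 0 = 0.
  apply/eqP; rewrite -[_ == 0]orbF -(gt_eqF (x := B 0 1) (y := 0)); last by lra.
  by rewrite -mulf_eq0; apply/eqP; nra.
have B01 : B 0 1 = 1 by nra.
apply/matrixP; do 2!elim/ord3; rewrite [RHS]mxE /=; lra.
Qed.

(** * Existence of the normal form and the two equivalence criteria *)

Section Equivalence.
Variables (R : realType) (N : nat).
Implicit Types (J : 'M[R]_(\sum_(i < N) 3)) (A B : 'M[R]_3) (M : 'M[R]_N).

Lemma mxdiag_SO3_inv (Phi : 'I_N -> 'M[R]_3) : (forall i, SO3 (Phi i)) ->
  invmx (\mxdiag_i Phi i) = \mxdiag_i (Phi i)^T.
Proof.
move=> SPhi; have PhiPhi : \mxdiag_i (Phi i)^T *m \mxdiag_i Phi i = 1%:M.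
  apply: eq_mulmx_cV => Y; rewrite -mulmxA mul1mx -[Y]submxcolK.
  rewrite !mul_mxdiag_mxcol; apply/eq_mxcol => i.
  by rewrite mulmxA (SPhi i).1 mul1mx.
have [_ uPhi] := mulmx1_unit PhiPhi.
by rewrite -[LHS]mul1mx -PhiPhi mulmxK.
Qed.

Lemma mxdiag_SO3_conj (Phi : 'I_N -> 'M[R]_3) J : (forall i, SO3 (Phi i)) ->
  \mxdiag_i Phi i *m J *m invmx (\mxdiag_i Phi i)
  = \mxblock_(i, j) (Phi i *m submxblock J i j *m (Phi j)^T).
Proof.
move=> SPhi; rewrite mxdiag_SO3_inv // -{1}[J]submxblockK.
by rewrite mul_mxdiag_mxblock mul_mxblock_mxdiag.
Qed.

(** The diagonal case is written with [M i j] so that the corner entry has one expression in both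
    cases. *)
Definition Jblock M (i j : 'I_N) : 'M[R]_3 :=
  if i == j then mx3 [:: [:: 0; 1; 0]; [:: -1; 0; 0]; [:: 0; 0; M i j]]
  else mx3 [:: [:: 0; 0; 0]; [:: 0; 0; 0]; [:: 0; 0; M i j]].

Lemma JmxE M : Jmx M = \mxblock_(i, j) Jblock M i j.
Proof. by apply/eq_mxblock => i j; rewrite /Jblock; case: eqVneq => [->|]. Qed.

Lemma Jblock22 M i j : Jblock M i j 2%:R 2%:R = M i j.
Proof. by rewrite /Jblock; case: eqP => _; rewrite mxE. Qed.

Lemma complex_structure_Jmx J : complex_structure (@su2N_bracket R N) J ->
  exists2 M : 'M[R]_N,
    M *m M = - 1%:M & equivalent_under (@SO3N R N) J (Jmx M).
Proof.
move=> csJ.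
have [Phi /all_and5[SPhi comm skew_gt0 rowPhi colPhi]] :=
  fin_all_exists (fun i => SO3_normal_block i csJ).
pose C i j := Phi i *m submxblock J i j *m (Phi j)^T.
pose M : 'M[R]_N := \matrix_(i, j) C i j 2%:R 2%:R.
pose Psi := \mxdiag_i Phi i.
have JC : Psi *m J *m invmx Psi = \mxblock_(i, j) C i j.
  exact: mxdiag_SO3_conj.
have uPsi : Psi \in unitmx.
  by apply: (SO3N_automorphism (Psi := Psi) _).1; exists Phi.
have C2 i j : \sum_k C i k *m C k j = (- (i == j)%:R)%:M.
  have : Psi *m J *m invmx Psi *m (Psi *m J *m invmx Psi) = - 1%:M.
    rewrite !mulmxA mulmxKV // -(mulmxA Psi J J) csJ.1.
    by rewrite mulmxN mulmx1 mulNmx mulmxV.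
  rewrite JC mul_mxblock -mxdiagZ -mxdiagN /mxdiag => /eq_mxblockP/(_ i j) ->.
  case: eqVneq => [_|_]; last by rewrite oppr0 raddf0.
  by rewrite conform_mx_id raddfN.
(* Killed by [hat e3] on both sides, an off-diagonal block retains only its corner entry. *)
have Coff i j : i != j ->
    C i j = mx3 [:: [:: 0; 0; 0]; [:: 0; 0; 0]; [:: 0; 0; M i j]].
  move=> nij; have rC : hat (e3 R) *m C i j = 0.
    by rewrite mulmxA rowPhi 1?eq_sym // mul0mx.
  have cC : C i j *m hat (e3 R) = 0.
    by rewrite /C -!mulmxA [X in Phi i *m X]mulmxA colPhi // mulmx0.
  move/matrixP: rC => rC; move/matrixP: cC => cC.
  have r0 k : C i j 0 k = 0.
    by have := rC 1 k; rewrite mxE sum3E !mxE /= ?mxE /=; lra.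
  have r1 k : C i j 1 k = 0.
    by have := rC 0 k; rewrite mxE sum3E !mxE /= ?mxE /=; lra.
  have c0 k : C i j k 0 = 0.
    by have := cC k 1; rewrite mxE sum3E !mxE /= ?mxE /=; lra.
  have c1 k : C i j k 1 = 0.
    by have := cC k 0; rewrite mxE sum3E !mxE /= ?mxE /=; lra.
  by apply/matrixP; do 2!elim/ord3; rewrite [RHS]mxE /= ?(r0, r1, c0, c1) ?mxE.
have Cdiag i : C i i = mx3 [:: [:: 0; 1; 0]; [:: -1; 0; 0]; [:: 0; 0; M i i]].
  (* The blocks [C i l] with [l != i] have zero first row, so [C i i] alone determines the first row
     of the (i, i) block of the square. *)
  have Cii k : (C i i *m C i i) 0 k = - (0 == k)%:R.
    have := C2 i i; rewrite eqxx (bigD1 i) //= => /matrixP/(_ 0 k).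
    rewrite mxE summxE big1 ?addr0 => [->|l nli]; first by rewrite mxE mulNrn.
    by rewrite (Coff i l) 1?eq_sym // mxE sum3E !mxE /=; ring.
  by rewrite [M i i]mxE; exact: hat_e3_commute_normal (comm i) (skew_gt0 i) Cii.
have CE i j : C i j = Jblock M i j.
  by rewrite /Jblock; case: eqVneq => [<-|nij]; [apply: Cdiag|apply: Coff].
have JM : Psi *m J *m invmx Psi = Jmx M.
  by rewrite JC JmxE; apply/eq_mxblock => i j.
exists M; last by exists Psi => //; exists Phi.
(* The third row of each block vanishes off its corner, so corners multiply as the entries of
   [M]. *)
apply/matrixP => i j; have /matrixP/(_ 2%:R 2%:R) := C2 i j.
rewrite summxE !mxE mulr1n => <-; apply: eq_bigr => k _.
rewrite !CE [RHS]mxE sum3E !Jblock22 /Jblock.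
by do 2!case: eqP => _; rewrite !mxE /= !mul0r !add0r.
Qed.

Lemma SO3N_1 : SO3N (1%:M : 'M[R]_(\sum_(i < N) 3)).
Proof.
exists (fun=> 1%:M); last by rewrite mxdiagZ.
by move=> i; split; rewrite ?det1 // trmx1 mul1mx.
Qed.

(** By duality: [tr (A B A^T hat x) = tr (B hat (A^T x))]. *)
Lemma skew_vec_conj A B : SO3 A ->
  skew_vec (A *m B *m A^T) = A *m skew_vec B.
Proof.
case=> AtA dA; have SAt : SO3 A^T by split; rewrite ?det_tr // trmxK mulmx1C.
apply/matrixP => l j; rewrite ord1 {j} [RHS]mxE.
have := mxtrace_mul_hat (A *m B *m A^T) (delta_mx l 0).
rewrite (bigD1 l) //= [X in _ + X]big1 => [|k nkl]; last first.
  by rewrite [delta_mx _ _ _ _]mxE (negPf nkl) mulr0.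
rewrite [delta_mx _ _ _ _]mxE !eqxx mulr1 addr0 => <-.
rewrite -!mulmxA mxtrace_mulC -!mulmxA -{2}[A]trmxK (mulmxA A^T) hat_conj //.
rewrite mxtrace_mul_hat; apply: eq_bigr => k _.
by rewrite -colE !mxE mulrC.
Qed.

Lemma equivalent_under_SO3N_Jmx M M' :
  equivalent_under (@SO3N R N) (Jmx M) (Jmx M') <-> M' = M.
Proof.
split=> [[_ [Phi SPhi ->]]|->]; last first.
  by exists 1%:M; [exact: SO3N_1|rewrite invmx1 mul1mx mulmx1].
rewrite mxdiag_SO3_conj // !JmxE => /eq_mxblockP JM'.
(* All diagonal blocks have axial data [2 e3], so [Phi i] fixes [e3]; by orthogonality so does its
   transpose, which gives its third row. *)
have Phi2 i k : Phi i 2%:R k = (2%:R == k)%:R.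
  have skewJ X : skew_vec (Jblock X i i) = 2 *: e3 R.
    rewrite /Jblock eqxx; apply: col3P; rewrite !mxE ?add0r ?ord3E /=; ring.
  have := congr1 (@skew_vec R) (JM' i i); rewrite mxblockK skew_vec_conj //.
  rewrite !skewJ -scalemxAr => /scalerI e3Phi.
  have := congr1 (mulmx (Phi i)^T) (e3Phi _).
  rewrite mulmxA (SPhi i).1 mul1mx pnatr_eq0.
  by rewrite -colE => /(_ isT)/matrixP/(_ k 0); rewrite !mxE eqxx andbT eq_sym.
apply/matrixP => i j; rewrite -(Jblock22 M') -(Jblock22 M) JM' mxblockK.
rewrite mxE sum3E !mxE !sum3E !Phi2 /=; ring.
Qed.

Lemma Jmx_perm_inv (s : 'S_N) M :
  Jmx (perm_inv_mx s M) = tau R s *m Jmx M *m invmx (tau R s).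
Proof.
have [utau _] := tau_automorphism R s.
apply: (canRL (mulmxK utau)); apply: eq_mulmx_cV => Y.
have JmxC X (Z : 'I_N -> 'cV[R]_3) :
    Jmx X *m \mxcol_i Z i = \mxcol_i \sum_j Jblock X i j *m Z j.
  by rewrite JmxE mul_mxblock_mxrow.
rewrite -[Y]submxcolK -!mulmxA mul_tau_mxcol !JmxC mul_tau_mxcol.
apply/eq_mxcol => i; rewrite (reindex_inj (@perm_inj _ s)) /=.
apply: eq_bigr => j _; rewrite permK; congr (_ *m _).
by rewrite /Jblock mxE permK -(inj_eq (@perm_inj _ s) _ j) permKV.
Qed.

Lemma equivalent_under_tau_SO3N_Jmx (s : 'S_N) M M' :
  equivalent_under (@tau_SO3N R N s) (Jmx M) (Jmx M') <-> M' = perm_inv_mx s M.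
Proof.
have [utau _] := tau_automorphism R s.
split=> [[_ [Phi SPhi ->] JM']|->]; last first.
  exists (tau R s); last exact: Jmx_perm_inv.
  by exists 1%:M; [exact: SO3N_1|rewrite mulmx1].
have [uPhi _] := SO3N_automorphism SPhi.
(* Pulling [M'] back along [s] cancels the factor [tau R s] and reduces the claim to equivalence
   under [SO3N]. *)
pose M0 : 'M[R]_N := \matrix_(i, j) M' (s i) (s j).
have M'E : M' = perm_inv_mx s M0 by apply/matrixP => i j; rewrite !mxE !permKV.
suff : equivalent_under (@SO3N R N) (Jmx M) (Jmx M0).
  by rewrite M'E => /equivalent_under_SO3N_Jmx ->.
exists Phi => //.
have Jconj : Jmx M' *m (tau R s *m Phi) = tau R s *m Phi *m Jmx M.
  by rewrite JM' mulmxKV // unitmx_mul utau.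
apply: (canRL (mulmxK uPhi)); apply: (can_inj (mulKmx utau)).
by rewrite [RHS]mulmxA -Jconj M'E Jmx_perm_inv !mulmxA mulmxKV.
Qed.

End Equivalence.

Theorem corollary6 (R : realType) (N : nat) (hN : (2 <= N)%N)
    (hNeven : ~~ odd N) :
  [/\ forall J : 'M[R]_(\sum_(i < N) 3),
        complex_structure (@su2N_bracket R N) J ->
        exists2 M : 'M[R]_N,
          M *m M = - 1%:M & equivalent_under (@SO3N R N) J (Jmx M),
      forall M M' : 'M[R]_N,
        M *m M = - 1%:M -> M' *m M' = - 1%:M ->
        (equivalent_under (@SO3N R N) (Jmx M) (Jmx M') <-> M' = M) &
      forall M M' : 'M[R]_N,
        M *m M = - 1%:M -> M' *m M' = - 1%:M ->
        forall s : 'S_N, Sigma s ->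
        (equivalent_under (@tau_SO3N R N s) (Jmx M) (Jmx M')
         <-> M' = perm_inv_mx s M)].
Proof.
split=> [J|M M' _ _|M M' _ _ s _].
- exact: complex_structure_Jmx.
- exact: equivalent_under_SO3N_Jmx.
- exact: equivalent_under_tau_SO3N_Jmx.
Qed.
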